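(* Let $m\ge0$, $k,k_0\in\mathbf{R}$, and $$H_{DC}=H\otimes I_4+I_4\otimes H+\frac{k_0}{|\mathbf x_1-\mathbf x_2|}I_{16},\qquad H=\vec\alpha\cdot\vec p+m\beta+\frac{k}{|\mathbf x|}I_4 .$$ Put $V(\mathbf x_1,\mathbf x_2)=\frac{k}{|\mathbf x_1|}+\frac{k}{|\mathbf x_2|}+\frac{k_0}{|\mathbf x_1-\mathbf x_2|}$. Let $\Psi\in\mathcal{H}\otimes\mathcal{H}=L^2(\mathbf{R}^6;M(2,\mathbf{C}))^4$, with $2\times 2$-matrix-valued components $\psi_{11},\psi_{12},\psi_{21},\psi_{22}$. Then $$H_{DC}\Psi=\begin{pmatrix}(2m+V)I_4&(h)_2&(h)_1&0\\ (h)_2&VI_4&0&(h)_1\\ (h)_1&0&VI_4&(h)_2\\ 0&(h)_1&(h)_2&-(2m-V)I_4\end{pmatrix}\begin{pmatrix}\psi_{11}(\mathbf x_1,\mathbf x_2)\\ \psi_{12}(\mathbf x_1,\mathbf x_2)\\ \psi_{21}(\mathbf x_1,\mathbf x_2)\\ \psi_{22}(\mathbf x_1,\mathbf x_2)\end{pmatrix},$$ where $$(h)_1\psi_{ij}=Mat\big[\big((\vec\sigma\cdot\vec p_1)\otimes I_2\big)\vec\psi_{ij}\big]=\sum_{l=1}^3(p_{1,l}\psi_{ij})\,{}^t\sigma_l,\qquad (h)_2\psi_{ij}=Mat\big[\big(I_2\otimes(\vec\sigma\cdot\vec p_2)\big)\vec\psi_{ij}\big]=\sum_{l=1}^3\s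igma_l\,(p_{2,l}\psi_{ij}).$$
   Context: Let $\vec p=-i\nabla$ on $\mathbf{R}^3$; on functions of $(\mathbf x_1,\mathbf x_2)\in\mathbf{R}^3\times\mathbf{R}^3$, $\vec p_j=(p_{j,1},p_{j,2},p_{j,3})=-i\nabla_{\mathbf x_j}$. Let $\sigma_1=\begin{pmatrix}0&1\\ 1&0\end{pmatrix}$, $\sigma_2=\begin{pmatrix}0&-i\\ i&0\end{pmatrix}$, $\sigma_3=\begin{pmatrix}1&0\\ 0&-1\end{pmatrix}$, $\alpha_j=\begin{pmatrix}0&\sigma_j\\ \sigma_j&0\end{pmatrix}$ $(j=1,2,3)$, $\beta=\begin{pmatrix}I_2&0\\ 0&-I_2\end{pmatrix}$; $\vec\alpha\cdot\vec p=\sum_j\alpha_jp_j$, $\vec\sigma\cdot\vec p=\sum_j\sigma_jp_j$. ${}^t$ denotes transposition. Let $\mathcal{H}=L^2(\mathbf{R}^3;\mathbf{C}^4)$. The tensor product $\mathcal{H}\otimes\mathcal{H}$ is identified with $L^2(\mathbf{R}^6;\mathbf{C}^4)^4$, with elements ${}^t(\vec\psi_{11},\vec\psi_{12},\vec\psi_{21},\vec\psi_{22})$, as follows: if $\psi={}^t(\psi_1,\psi_2)$ and $\psi'={}^t(\psi_1',\psi_2')$ are in $\mathcal{H}$, with upper and lower parts $\psi_a={}^t(\psi_{a1},\psi_{a2})$, $\psi'_b={}^t(\psi'_{b1},\psi'_{b2})\in L^2(\mathbf{R}^3;\mathbf{C}^2)$, then the $(a,b)$ block of $\psi\otimes\psi'$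 is ${}^t\big(\psi_{a1}(\mathbf x_1)\psi'_{b1}(\mathbf x_2),\ \psi_{a1}(\mathbf x_1)\psi'_{b2}(\mathbf x_2),\ \psi_{a2}(\mathbf x_1)\psi'_{b1}(\mathbf x_2),\ \psi_{a2}(\mathbf x_1)\psi'_{b2}(\mathbf x_2)\big)$. $H\otimes I_4$ (resp. $I_4\otimes H$) is $H$ acting on the first (resp. second) factor. For $2\times2$ matrices, $A\otimes B=(a_{ij}B)$ is the Kronecker product. For $\vec a={}^t(a_1,a_2,a_3,a_4)\in\mathbf{C}^4$ put $Mat[\vec a]=\begin{pmatrix}a_1&a_3\\ a_2&a_4\end{pmatrix}$; each block $\vec\psi_{ij}$ is identified with the matrix-valued function $\psi_{ij}=Mat[\vec\psi_{ij}]$, which identifies $\mathcal{H}\otimes\mathcal{H}$ with $L^2(\mathbf{R}^6;M(2,\mathbf{C}))^4$. In the block matrix, $I_4$ is the identity on the four-dimensional space $M(2,\mathbf{C})\cong\mathbf{C}^4$, so $(2m+V)I_4$, $VI_4$ and $-(2m-V)I_4$ act by scalar multiplication. *)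

(* Defs.v *)
From HB Require Import structures.
From mathcomp Require Import all_boot all_order all_algebra.
From mathcomp Require Import all_classical all_reals all_analysis.
From mathcomp Require Import complex mxtens.

Set Implicit Arguments.
Unset Strict Implicit.
Unset Printing Implicit Defensive.

Import Order.TTheory GRing.Theory Num.Theory.
Import numFieldNormedType.Exports.

Local Open Scope classical_set_scope.
Local Open Scope ring_scope.
Local Open Scope complex_scope.

(* For Psi in L^2 the functions Psi, k/|x_j| Psi and k0/|x_1 - x_2| Psi are
   locally integrable on R^6, so H_DC Psi is a distribution for every Psi in
   L^2.  Operators therefore map functions to distributions, derivatives being
   taken in the distributional sense. *)

Section TestFunctions.
Context {R : realType} {V : normedModType R}.

(* On a finite-dimensional V this is C^oo. *)
Definition smooth (f : V -> R) : Prop :=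
  forall (vs : seq V) (x : V),
    differentiable (foldr (fun v g => 'D_v g) f vs) x.

Record testfun := TestFun {
  tf :> V -> R[i];
  tf_Re : smooth (fun x => complex.Re (tf x));
  tf_Im : smooth (fun x => complex.Im (tf x));
  tf_supp : compact (closure [set x | tf x != 0]) }.

Definition cderive (v : V) (f : V -> R[i]) (x : V) : R[i] :=
  'D_v (fun y => complex.Re (f y)) x +i* 'D_v (fun y => complex.Im (f y)) x.

Lemma smooth_derive (v : V) (f : V -> R) : smooth f -> smooth ('D_v f).
Proof. by move=> sf vs x; have := sf (rcons vs v) x; rewrite foldr_rcons. Qed.

Lemma supp_derive (v : V) (f : V -> R[i]) :
  closure [set x | cderive v f x != 0] `<=` closure [set x | f x != 0].
Proof.
rewrite [X in X `<=` _]closureE.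
apply: smallest_sub; first exact: closed_closure.
move=> x /= fx; apply: contrapT => nx; move/eqP: fx; apply.
have fx0 : \forall y \near x, f y = 0.
  have : nbhs x (~` closure [set x | f x != 0]).
    by apply: open_nbhs_nbhs; split => //; exact/closed_openC/closed_closure.
  apply: filterS => y ny; apply: contrapT => /eqP fy.
  by apply: ny; exact: subset_closure.
rewrite /cderive; congr (_ +i* _);
  by rewrite (@near_eq_derive _ _ _ _ (cst 0)) ?derive_cst//;
     apply: filterS fx0 => y ->.
Qed.

Definition derive_test (v : V) (phi : testfun) : testfun :=
  @TestFun (cderive v phi)
    (smooth_derive v (tf_Re phi)) (smooth_derive v (tf_Im phi))
    (subclosed_compact (@closed_closure _ _) (@tf_supp phi)
       (@supp_derive v phi)).

End TestFunctions.
Arguments testfun {R} V.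

(* Functionals on complex test functions, with the bilinear pairing.
   Continuity is not part of the type: it plays no role in whether two
   distributions are equal. *)
Definition dist (R : realType) (V : normedModType R) : Type :=
  testfun V -> (R[i])^o.
HB.instance Definition _ (R : realType) (V : normedModType R) :=
  GRing.Lmodule.on (dist V).

Definition mom (R : realType) (V : normedModType R) (v : V) (T : dist V) :
  dist V := - 'i *: (fun phi => - T (derive_test v phi) : (R[i])^o).

Definition opmul (E : Type) (D : nmodType) m n
    (A : 'M[E -> D]_(m, n)) (x : 'cV[E]_n) : 'cV[D]_m :=
  \col_i \sum_j A i j (x j 0).

Section OperatorMatrices.
Context {R : realType} {E : Type} {D : lmodType R[i]}.

Definition opdot n (g : 'I_3 -> 'M[R[i]]_n) (p : 'I_3 -> E -> D) :
  'M[E -> D]_n := \matrix_(i, j) \sum_l g l i j *: p l.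

(* Kronecker products A (x) B = (a_ij B) in which one of the factors is a
   matrix of operators and the other one is a matrix of numbers. *)
Definition kronl m n (A : 'M[E -> D]_m) (B : 'M[R[i]]_n) :
    'M[E -> D]_(m * n) :=
  \matrix_(r, c) (B (mxtens_unindex r).2 (mxtens_unindex c).2 *:
                  A (mxtens_unindex r).1 (mxtens_unindex c).1).

Definition kronr m n (A : 'M[R[i]]_m) (B : 'M[E -> D]_n) :
    'M[E -> D]_(m * n) :=
  \matrix_(r, c) (A (mxtens_unindex r).1 (mxtens_unindex c).1 *:
                  B (mxtens_unindex r).2 (mxtens_unindex c).2).

End OperatorMatrices.

Definition seqmx (M : nmodType) m n (rows : seq (seq M)) : 'M[M]_(m, n) :=
  \matrix_(i, j) nth 0 (nth [::] rows i) j.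
Arguments seqmx {M m n} rows.

Section Matrices.
Context {R : realType}.

Definition sigma (l : 'I_3) : 'M[R[i]]_2 :=
  nth 0 [:: seqmx [:: [:: 0; 1]; [:: 1; 0]];
            seqmx [:: [:: 0; - 'i]; [:: 'i; 0]];
            seqmx [:: [:: 1; 0]; [:: 0; -1]] ] l.

Definition alpha (l : 'I_3) : 'M[R[i]]_4 :=
  (block_mx 0 (sigma l) (sigma l) 0 : 'M[R[i]]_(2 + 2)).

Definition beta : 'M[R[i]]_4 :=
  (block_mx 1%:M 0 0 (- 1%:M) : 'M[R[i]]_(2 + 2)).

End Matrices.

Definition Mat (E : nmodType) (a : 'cV[E]_4) : 'M[E]_2 :=
  seqmx [:: [:: a 0 0; a 2 0]; [:: a 1 0; a 3 0]].

Definition vec (E : nmodType) (X : 'M[E]_2) : 'cV[E]_4 :=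
  seqmx [:: [:: X 0 0]; [:: X 1 0]; [:: X 0 1]; [:: X 1 1]].

Definition stack (E : nmodType) (X : 'M['cV[E]_4]_2) : 'cV['M[E]_2]_4 :=
  seqmx [:: [:: Mat (X 0 0)]; [:: Mat (X 0 1)];
            [:: Mat (X 1 0)]; [:: Mat (X 1 1)]].

Section ProductMeasure.
Context d1 d2 (T1 : measurableType d1) (T2 : measurableType d2) (R : realType).
Variables (m1 : {sigma_finite_measure set T1 -> \bar R})
  (m2 : {sigma_finite_measure set T2 -> \bar R}).

(* The library's m1 \x m2 does not carry its sigma-finite structure. *)
Definition pmeas : set (T1 * T2)%type -> \bar R := (m1 \x m2)%E.
HB.instance Definition _ := Measure.on pmeas.

Let pmeas_sigma_finite : sigma_finite setT pmeas.
Proof.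
have /sigma_finiteP[F [TF ndF Foo]] := sigma_finiteT m1.
have /sigma_finiteP[G [TG ndG Goo]] := sigma_finiteT m2.
exists (fun n => F n `*` G n).
  rewrite -setXTT TF TG predeqE => -[x y]; split.
    move=> [/= [n _ Fnx] [k _ Gky]]; exists (maxn n k) => //; split.
    - by move: x Fnx; exact/subsetPset/ndF/leq_maxl.
    - by move: y Gky; exact/subsetPset/ndG/leq_maxr.
  by move=> [n _ []/= ? ?]; split; exists n.
move=> k; have [? ?] := Foo k; have [? ?] := Goo k.
split; first exact: measurableX.
by rewrite /pmeas product_measure1E// lte_mul_pinfty// ge0_fin_numE.
Qed.
HB.instance Definition _ :=
  Measure_isSigmaFinite.Build _ _ _ pmeas pmeas_sigma_finite.

End ProductMeasure.

Notation R3 R := (R * R * R)%type.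
Notation R6 R := (R3 R * R3 R)%type.

(* The Euclidean norm; the library norm of a product is the sup norm. *)
Definition enorm (R : realType) (x : R3 R) : R :=
  Num.sqrt (x.1.1 ^+ 2 + x.1.2 ^+ 2 + x.2 ^+ 2).

Definition e3 (R : realType) (l : 'I_3) : R3 R :=
  ((l == 0)%:R, (l == 1)%:R, (l == 2)%:R).

(* Differential expressions on a space V with integral I; below V is R^3 or
   R^6 with the Lebesgue integral. *)
Section Expressions.
Context {R : realType} {V : normedModType R} (I : (V -> R) -> R).
Local Notation F := (V -> R[i]).
Local Notation D := (dist V).

Definition reg (f : F) : D := fun phi =>
  I (fun x => complex.Re (f x * phi x)) +i*
  I (fun x => complex.Im (f x * phi x)).

(* Since 1 / 0 = 0, a Coulomb potential U vanishes at its poles, which form a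
   null set. *)
Definition mulpot (U : V -> R) (f : F) : D := reg (fun x => (U x)%:C * f x).

Definition diagop n (T : F -> D) : 'M[F -> D]_n :=
  \matrix_(i, j) (if i == j then T else 0).

(* alpha.p + m beta + (k/|x|) I_4 in the variable x, where e l is the direction
   of the l-th coordinate of x. *)
Definition dirac_op (e : 'I_3 -> V) (x : V -> R3 R) (m k : R) : 'M[F -> D]_4 :=
  opdot alpha (fun l f => mom (e l) (reg f))
  + map_mx (fun c => c *: reg) (m%:C *: beta)
  + diagop 4 (mulpot (fun z => k / enorm (x z))).

End Expressions.

Section TwoBody.
Context {R : realType}.

Definition leb3 :=
  pmeas (pmeas (@lebesgue_measure R) (@lebesgue_measure R))
        (@lebesgue_measure R).
Definition leb6 := pmeas leb3 leb3.
Definition int3 (f : R3 R -> R) : R := \int[leb3]_x f x.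
Definition int6 (f : R6 R -> R) : R := \int[leb6]_x f x.

Local Notation F := (R6 R -> R[i]).
Local Notation D := (dist (R6 R)).

Definition L2 (f : F) : Prop :=
  ((fun x => complex.Re (f x)) \in @Lfun _ _ R leb6 2%:E) /\
  ((fun x => complex.Im (f x)) \in @Lfun _ _ R leb6 2%:E).

Definition p1 (l : 'I_3) (f : F) : D := mom (e3 R l, 0) (reg int6 f).
Definition p2 (l : 'I_3) (f : F) : D := mom (0, e3 R l) (reg int6 f).

(* The one-particle operator, and the same expression in the variable x_1,
   resp. x_2. *)
Definition H (m k : R) : 'M[(R3 R -> R[i]) -> dist (R3 R)]_4 :=
  dirac_op int3 (e3 R) id m k.
Definition H_1 (m k : R) : 'M[F -> D]_4 :=
  dirac_op int6 (fun l => (e3 R l, 0)) fst m k.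
Definition H_2 (m k : R) : 'M[F -> D]_4 :=
  dirac_op int6 (fun l => (0, e3 R l)) snd m k.

Definition HDC (m k k0 : R) : 'M[F -> D]_(4 * 4) :=
  kronl (H_1 m k) 1%:M + kronr 1%:M (H_2 m k)
  + diagop (4 * 4) (mulpot int6 (fun z => k0 / enorm (z.1 - z.2))).

(* A 4-spinor index is the pair (a, i) of its block and its position in the
   block. *)
Definition spin (a i : 'I_2) : 'I_4 := mxtens_index (a, i).

(* An element of the tensor square of L^2(R^3; C^4) is stored as its blocks,
   X a b being the (a, b) block; [flat] and [unflat] translate to and from the
   order of the Kronecker products in HDC. *)
Definition flat (E : Type) (X : 'M['cV[E]_4]_2) : 'cV[E]_(4 * 4) :=
  \col_r let: (s, t) := @mxtens_unindex 4 4 r in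
    let: (a, i) := @mxtens_unindex 2 2 s in
    let: (b, j) := @mxtens_unindex 2 2 t in X a b (spin i j) 0.

Definition unflat (E : Type) (v : 'cV[E]_(4 * 4)) : 'M['cV[E]_4]_2 :=
  \matrix_(a, b) \col_r let: (i, j) := @mxtens_unindex 2 2 r in
    v (@mxtens_index 4 4 (spin a i, spin b j)) 0.

Definition applyHDC (m k k0 : R) (Psi : 'M['cV[F]_4]_2) : 'M['cV[D]_4]_2 :=
  unflat (opmul (HDC m k k0) (flat Psi)).

Definition Vpot (k k0 : R) (z : R6 R) : R :=
  k / enorm z.1 + k / enorm z.2 + k0 / enorm (z.1 - z.2).

(* U I_4 on M(2, C)-valued functions. *)
Definition scal (U : R6 R -> R) (X : 'M[F]_2) : 'M[D]_2 :=
  map_mx (mulpot int6 U) X.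

Definition sigp1_I : 'M[F -> D]_4 :=
  kronl (opdot sigma p1) (1%:M : 'M[R[i]]_2).
Definition I_sigp2 : 'M[F -> D]_4 :=
  kronr (1%:M : 'M[R[i]]_2) (opdot sigma p2).

Definition h1 (X : 'M[F]_2) : 'M[D]_2 := Mat (opmul sigp1_I (vec X)).
Definition h2 (X : 'M[F]_2) : 'M[D]_2 := Mat (opmul I_sigp2 (vec X)).

End TwoBody.

(* Products of a matrix of numbers with a matrix of distributions. *)
Definition lmx (C : nzRingType) (E : lmodType C) m n p
    (A : 'M[C]_(m, n)) (X : 'M[E]_(n, p)) : 'M[E]_(m, p) :=
  \matrix_(i, j) \sum_l A i l *: X l j.

Definition rmx (C : nzRingType) (E : lmodType C) m n p
    (X : 'M[E]_(m, n)) (A : 'M[C]_(n, p)) : 'M[E]_(m, p) :=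
  \matrix_(i, j) \sum_l A l j *: X i l.

(* psi (x) psi', block by block. *)
Definition tens (R : realType) (psi psi' : 'cV[R3 R -> R[i]]_4) :
    'M['cV[R6 R -> R[i]]_4]_2 :=
  let up_low (f : 'cV[R3 R -> R[i]]_4) (a i : 'I_2) : R3 R -> R[i] :=
    (f : 'cV[R3 R -> R[i]]_(2 + 2))
      (if a == 0 then lshift 2 i else rshift 2 i) 0 in
  \matrix_(a, b)
    let pr i j (z : R6 R) := up_low psi a i z.1 * up_low psi' b j z.2 in
    seqmx [:: [:: pr 0 0]; [:: pr 0 1]; [:: pr 1 0]; [:: pr 1 1]].

Lemma ord2P (P : 'I_2 -> Prop) : P 0 -> P 1 -> forall i, P i.
Proof.
move=> P0 P1 [[|[|//]] h]; [have -> : Ordinal h = 0 | have -> : Ordinal h = 1];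
  by [apply: val_inj|].
Qed.

Lemma vecK (E : nmodType) : cancel (@vec E) (@Mat E).
Proof.
by move=> X; apply/matrixP => i j; rewrite /Mat /vec !mxE;
   move: i j; apply: ord2P; apply: ord2P.
Qed.

Lemma flatK (E : Type) : cancel (@flat E) (@unflat E).
Proof.
move=> X; apply/matrixP => a b; apply/colP => r; rewrite mxE !mxE.
case E1: (@mxtens_unindex 2 2 r) => [i j]; rewrite mxE mxtens_indexK.
by rewrite /spin !mxtens_indexK -E1 mxtens_unindexK.
Qed.

Lemma flat_tens (R : realType) (psi psi' : 'cV[R3 R -> R[i]]_4)
    (s t : 'I_4) :
  flat (tens psi psi') (mxtens_index (s, t)) 0 =
  fun z => psi s 0 z.1 * psi' t 0 z.2.
Proof.
have S (a i : 'I_2) :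
    (if a == 0 then lshift 2 i else rshift 2 i) = mxtens_index (a, i) :> 'I_4.
  by move: a i; do 2! (apply: ord2P); apply: val_inj.
rewrite /flat mxE mxtens_indexK.
case: (@mxtens_indexP 2 2 s) => a i; case: (@mxtens_indexP 2 2 t) => b j.
rewrite /tens !mxtens_indexK mxE -!S.
by move: i j; do 2! (apply: ord2P); rewrite mxE.
Qed.

(* Main.v *)
Require Import Defs.
From HB Require Import structures.
From mathcomp Require Import all_boot all_order all_algebra.
From mathcomp Require Import all_classical all_reals all_analysis.
From mathcomp Require Import complex mxtens ring lra.
From mathcomp Require Import measurable_realfun.

(** The entries of [H_DC] are computed blockwise: as [alpha] exchanges upper
    and lower components while [beta] and the potentials preserve them, the
    first factor contributes [sigma.p_1] applied to the block with flipped [a],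
    the second [sigma.p_2] applied to the block with flipped [b], and the
    remaining terms multiply the [(a, b)] block by
    [((-1)^a + (-1)^b) m + V].  The analytic point is that these terms, each a
    distribution of its own, add up to multiplication by the sum of the
    functions: this needs every [U psi phi] to be integrable, hence [1/|x_1|],
    [1/|x_2|] and [1/|x_1 - x_2|] to be locally square integrable on R^6.  On
    the dyadic shell [2^-(n+1) < |x| <= 2^-n] one has [1/|x|^2 < 4^(n+1)],
    and the part of a box where [|x| <= 2^-n] has measure [O(8^-n)], so the
    integral is bounded by a geometric series. *)

Set Implicit Arguments.
Unset Strict Implicit.
Unset Printing Implicit Defensive.

Import Order.TTheory GRing.Theory Num.Theory.
Import numFieldNormedType.Exports.

Local Open Scope ring_scope.

(** * Measurability of continuous functions on R^6 *)

Section MeasurableBasis.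
Local Open Scope classical_set_scope.

(* A base that is both countable and measurable puts the open sets of a product
   into the product sigma-algebra, which fails for general factors. *)
Definition mbasis (T : topologicalType) (M : set (set T)) :=
  exists2 B : set (set T), countable B & basis B /\ B `<=` M.

Lemma mbasis_prod (U V : topologicalType) (MU : set (set U))
    (MV : set (set V)) (M : set (set (U * V))) :
  (forall A B, MU A -> MV B -> M (A `*` B)) ->
  mbasis MU -> mbasis MV -> mbasis M.
Proof.
move=> MX [B cB [[oB bB] BM]] [C cC [[oC bC] CM]].
exists ((fun p : set U * set V => p.1 `*` p.2) @` (B `*` C)).
  by apply: sub_countable (card_image_le _ _) _; exact: countableX.
split; last by move=> _ [[P Q] [/= BP CQ] <-]; apply: MX; [exact: BM|exact: CM].
split.
  move=> _ [[P Q] [/= /oB oP /oC oQ] <-]; rewrite openE => x [xP xQ].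
  exists (P, Q) => //; split.
    by apply: open_nbhs_nbhs.
  by apply: open_nbhs_nbhs.
move=> x W [[P Q] [/= nP nQ] PQW].
have [P' [BP' P'x] P'P] := bB x.1 P nP.
have [Q' [CQ' Q'x] Q'Q] := bC x.2 Q nQ.
exists (P' `*` Q'); first by split=> //; exists (P', Q').
by move=> z [z1 z2]; apply: PQW; split; [exact: P'P|exact: Q'Q].
Qed.

(** An open set is the union of the base members that it contains, and countability of the base
    makes this a countable union inside [M]. *)
Lemma mbasis_open (T : topologicalType) (M : set (set T)) (A : set T) :
  (forall D, countable D -> D `<=` M -> M (\bigcup_(X in D) X)) ->
  mbasis M -> open A -> M A.
Proof.
move=> MU [B cB [[oB bB] BM]] oA.
have -> : A = \bigcup_(X in B `&` [set X | X `<=` A]) X.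
  apply/seteqP; split=> [x Ax|x [X [_ XA] Xx]]; last exact: XA.
  have [X [BX Xx] XA] := bB x A (open_nbhs_nbhs (conj oA Ax)).
  by exists X.
apply: MU; last by move=> X [BX _]; exact: BM.
by apply: sub_countable cB; apply: subset_card_le; exact: subIsetl.
Qed.

Lemma mbasis_real (R : realType) :
  mbasis [set X : set R | (measurable X : Prop)].
Proof.
pose b (p : rat * rat) : set R := ball (ratr p.1 : R) (ratr p.2).
exists (range b); first exact: sub_countable (card_image_le _ _) (countableP _).
split; last first.
  by move=> _ [p _ <-]; rewrite /= /b ball_itv; exact: measurable_itv.
split; first by move=> _ [p _ <-]; exact: ball_open.
move=> x W Wx.
have [|c [r [/= xB BW]]] := @open_subball_rat R _ x (open_interior W).
  exact/mem_set.
exists (b (c, r)); first by split; [exists (c, r)|exact: set_mem].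
by move=> z /BW; exact: interior_subset.
Qed.

End MeasurableBasis.

Section R6Measurability.
Local Open Scope classical_set_scope.
Variable R : realType.

Lemma open_measurable_R6 (A : set (R6 R)) : open A -> measurable A.
Proof.
apply: (@mbasis_open _ [set X : set (R6 R) | measurable X]).
  move=> D cD DM; rewrite bigcup_set_type /=.
  apply: countable_bigcupT_measurable => [|X]; last first.
    exact: DM _ (set_mem (valP X)).
  by rewrite (eq_countable (card_setT _)).
have m2 : mbasis [set X : set (R * R) | measurable X].
  by apply: mbasis_prod (mbasis_real R) (mbasis_real R); exact: measurableX.
have m3 : mbasis [set X : set (R3 R) | measurable X].
  by apply: mbasis_prod m2 (mbasis_real R); exact: measurableX.
by apply: (mbasis_prod _ m3 m3) => X Y; exact: measurableX.
Qed.

Lemma continuous_measurable_R6 (f : R6 R -> R) :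
  continuous f -> measurable_fun setT f.
Proof.
move=> cf; apply: (measurability _ (RGenOpens.measurableE R)).
move=> _ [_ [a [b ->] <-]]; rewrite setTI.
by apply: open_measurable_R6; apply: open_comp => //; exact: interval_open.
Qed.

End R6Measurability.

(** * Local square integrability of the Coulomb potential *)

Lemma pmeasE d1 d2 (T1 : measurableType d1) (T2 : measurableType d2)
    (R : realType) (m1 : {sigma_finite_measure set T1 -> \bar R})
    (m2 : {sigma_finite_measure set T2 -> \bar R}) (A : set T1) (B : set T2) :
  measurable A -> measurable B ->
  pmeas m1 m2 (A `*` B)%classic = (m1 A * m2 B)%E.
Proof. exact: product_measure1E. Qed.

Section Coulomb.
Variable R : realType.
Local Open Scope classical_set_scope.

(** The norm of a product is the sup norm, so its closed balls are cubes, with an explicit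
    volume. *)
Lemma cubeE (c : R3 R) (r : R) :
  [set x | `|x - c| <= r] =
    (`[c.1.1 - r, c.1.1 + r] `*` `[c.1.2 - r, c.1.2 + r])
    `*` `[c.2 - r, c.2 + r].
Proof.
apply/seteqP; split=> [[[x y] z]|[[x y] z]] /=;
  rewrite !in_itv/= !prod_normE/= !ge_max -!ler_distlC.
  by rewrite !(distrC c.1.1, distrC c.1.2, distrC c.2) => /andP[/andP[]].
by rewrite !(distrC c.1.1, distrC c.1.2, distrC c.2) => -[[-> ->] ->].
Qed.

Lemma measurable_cube (c : R3 R) (r : R) :
  measurable [set x : R3 R | `|x - c| <= r].
Proof. by rewrite cubeE; apply: measurableX => //; exact: measurableX. Qed.

Lemma leb3_cube (c : R3 R) (r : R) : 0 <= r ->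
  leb3 [set x | `|x - c| <= r] = ((2 * r) ^+ 3)%:E.
Proof.
move=> r0; rewrite cubeE.
have E x : lebesgue_measure `[x - r, x + r] = (2 * r)%:E.
  rewrite lebesgue_measure_itv/= lte_fin; case: ifPn => [_|].
    by rewrite -EFinB; congr EFin; ring.
  (* The interval formula returns 0 unless the endpoints are strictly ordered; this is the
     degenerate case [r = 0]. *)
  by rewrite -leNgt => h; congr EFin; lra.
pose I x := `[x - r, x + r] : set R.
transitivity (lebesgue_measure (I c.1.1) * lebesgue_measure (I c.1.2) *
    lebesgue_measure (I c.2))%E.
  rewrite [LHS]pmeasE//; last exact: measurableX.
  by congr (_ * _)%E; exact: pmeasE.
by rewrite !E -!EFinM; congr EFin; ring.
Qed.

(** Tonelli: the section over [x] lies in the cube of half-side [r] about [g x], whose volume does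
    not depend on its centre, and it is empty unless [|x| <= s]. The moving centre serves for the
    singularity along x_1 = x_2. *)
Lemma leb6_slab (A : set (R6 R)) (g : R3 R -> R3 R) (s r : R) :
  0 <= s -> 0 <= r -> measurable A ->
  (forall z, A z -> `|z.1| <= s /\ `|z.2 - g z.1| <= r) ->
  (leb6 A <= ((2 * s) ^+ 3 * (2 * r) ^+ 3)%:E)%E.
Proof.
move=> s0 r0 mA Asub.
pose B := [set x : R3 R | `|x - 0| <= s].
have mB : measurable B by exact: measurable_cube.
have -> : leb6 A = (\int[leb3]_x leb3 (xsection A x))%E by [].
apply: (@le_trans _ _ (\int[leb3]_x (((2 * r) ^+ 3)%:E * (\1_B x)%:E))%E).
  apply: ge0_le_integral => //.
  - exact: (measurable_fun_xsection leb3 mA).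
  - by apply/measurable_EFinP; apply: measurable_funM.
  move=> x _; rewrite indicE; have [xB|xB] := boolP (x \in B).
    rewrite mule1 -(leb3_cube (g x))//.
    apply: le_measure; rewrite ?inE; [exact: measurable_xsection| |].
      exact: measurable_cube.
    by move=> y /xsectionP /Asub[].
  have -> : xsection A x = set0.
    apply/seteqP; split=> // y /xsectionP /Asub[/= xs _].
    by move/negP: xB; apply; rewrite inE /B /= subr0.
  by rewrite mule0 [X in (X <= _)%E]measure0.
rewrite ge0_integralZl// ?lee_fin ?exprn_ge0 ?mulr_ge0//; last first.
  exact/measurable_EFinP.
by rewrite integral_indic// setIT [X in (_ * X)%E](leb3_cube 0 s0) -EFinM mulrC.
Qed.

(** Induction on [N]: if y > 2^-N the new term vanishes; otherwise 2^-(N+1) < y, and the new term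
    4^(N+1) alone dominates 1/y^2. The summand 1 takes care of y > 1. *)
Lemma exprVn_le_dyadic (y : R) N : 2 ^- N < y ->
  y^-1 ^+ 2 <= 1 + \sum_(0 <= n < N) 4 ^+ n.+1 * (y <= 2 ^- n)%R%:R.
Proof.
elim: N => [|N IH] yN.
  rewrite big_nil addr0 exprVn invf_le1 ?exprn_gt0//.
    by rewrite exprn_ege1// ltW// (le_lt_trans _ yN)// expr0 invr1.
  by rewrite (le_lt_trans _ yN).
rewrite big_nat_recr//=.
have [yl|/IH h] := leP y (2 ^- N); last first.
  by rewrite mulr0 addr0.
rewrite mulr1 addrA ler_wpDl//.
  by rewrite addr_ge0// sumr_ge0// => i _; rewrite mulr_ge0// exprn_ge0.
have y0 : 0 < y by rewrite (lt_trans _ yN).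
have -> : 4 ^+ N.+1 = (2 ^+ N.+1) ^+ 2 :> R.
  by rewrite -exprM mulnC exprM; congr (_ ^+ _); ring.
rewrite lerXn2r ?nnegrE ?exprn_ge0//.
- by rewrite invr_ge0 ltW.
by rewrite -[leRHS]invrK lef_pV2 ?posrE// ltW.
Qed.

End Coulomb.

Section CoulombL2.
Variable R : realType.
Local Open Scope classical_set_scope.

(** This puts a Euclidean ball inside the cube of the same radius, where volumes are computed. *)
Lemma norm_le_enorm (x : R3 R) : `|x| <= enorm x.
Proof.
have sq (a b : R) : 0 <= b -> `|a| <= Num.sqrt (a ^+ 2 + b).
  by move=> b0; rewrite -sqrtr_sqr ler_sqrt ?addr_ge0 ?sqr_ge0// lerDl.
rewrite !prod_normE !ge_max /enorm; apply/andP; split; [apply/andP; split|].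
- by rewrite -addrA sq// addr_ge0// sqr_ge0.
- by rewrite [_ ^+ 2 + x.1.2 ^+ 2]addrC -addrA sq// addr_ge0// sqr_ge0.
- by rewrite addrC sq// addr_ge0// sqr_ge0.
Qed.

Lemma continuous_enorm : continuous (@enorm R).
Proof.
have -> : @enorm R =
  Num.sqrt \o (fun x => x.1.1 ^+ 2 + x.1.2 ^+ 2 + x.2 ^+ 2) by [].
move=> x; apply: continuous_comp; last exact: sqrt_continuous.
have X (f : R3 R -> R) : continuous f -> continuous (fun y => f y ^+ 2).
  move=> cf y; apply: (@continuous_comp _ _ _ f (fun t => t ^+ 2)).
    exact: cf.
  exact: exprn_continuous.
apply: continuousD; first apply: continuousD.
- by apply: (X (fun y => y.1.1)) => y; apply: continuous_comp;
    exact: cvg_fst.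
- by apply: (X (fun y => y.1.2)) => y; apply: continuous_comp;
    [exact: cvg_fst|exact: cvg_snd].
- by apply: (X (fun y => y.2)) => y; exact: cvg_snd.
Qed.

Lemma measurable_inv_enorm (c : R6 R -> R3 R) : continuous c ->
  measurable_fun setT (fun z => (enorm (c z))^-1).
Proof.
move=> cc.
(* As a real power the inverse is a measurable function; the two agree at 0 as well, where both are
   0. *)
have -> : (fun z => (enorm (c z))^-1) = (@powR R ^~ (-1)) \o (@enorm R \o c).
  by apply/funext => z /=; rewrite powR_inv1// sqrtr_ge0.
apply: measurableT_comp => //.
by apply: continuous_measurable_R6 => z; apply: continuous_comp;
  [exact: cc|exact: continuous_enorm].
Qed.

Definition box (M : R) : set (R6 R) := [set z | `|z| <= M].

Lemma measurable_norm_le (V : normedModType R) (c : R6 R -> V) (r : R) :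
  continuous c -> measurable [set z | `|c z| <= r].
Proof.
move=> cc; have -> : [set z | `|c z| <= r] = (fun z => `|c z|) @^-1` `]-oo, r].
  by apply/seteqP; split=> z; rewrite /= in_itv.
rewrite -[X in measurable X]setTI; apply: (_ : measurable_fun _ _) => //.
by apply: continuous_measurable_R6 => z; apply: continuous_comp;
   [exact: cc|exact: norm_continuous].
Qed.

Lemma measurable_box (M : R) : measurable (box M).
Proof. by apply: (@measurable_norm_le _ id) => x; exact: cvg_id. Qed.

Lemma leb6_box (M : R) : 0 <= M -> (leb6 (box M) < +oo)%E.
Proof.
move=> M0; apply: le_lt_trans (ltry _).
apply: (leb6_slab (g := cst 0) M0 M0 (measurable_box M)) => z.
by rewrite /box /= subr0 prod_normE ge_max => /andP.
Qed.

(** At [r = 2^-n] the hypothesis bounds the contribution of the [n]-th dyadic term by 4^(n+1) K 8^-n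
    = 4 K 2^-n. All three potentials are covered, with [c z] equal to x_1, x_2 or x_1 - x_2. *)
Lemma integral_sqr_inv_enorm (c : R6 R -> R3 R) (M K : R) :
  continuous c -> 0 <= M ->
  (forall r, 0 <= r ->
    (leb6 (box M `&` [set z | (`|c z| <= r)%R]) <= (K * r ^+ 3)%:E)%E) ->
  (\int[leb6]_(z in box M) ((enorm (c z))^-1 ^+ 2)%:E < +oo)%E.
Proof.
move=> cc M0 leK.
pose A n := box M `&` [set z | `|c z| <= 2 ^- n].
have mA n : measurable (A n).
  by apply: measurableI; [exact: measurable_box|exact: measurable_norm_le].
pose a n z : \bar R := (4 ^+ n.+1 * \1_(A n) z)%:E.
have ma n D : measurable_fun D (a n).
  by apply/measurable_EFinP/measurable_funM => //; exact/measurable_funTS.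
have a0 n z : (0 <= a n z)%E by rewrite lee_fin mulr_ge0// exprn_ge0.
have mS : measurable_fun (box M) (fun z => \sum_(0 <= n <oo) a n z)%E.
  by apply: (@ge0_emeasurable_sum _ _ _ _ a predT) => [n z _ _|n _].
have pt z : box M z ->
    (((enorm (c z))^-1 ^+ 2)%:E <= 1 + \sum_(0 <= n <oo) a n z)%E.
  (* At a pole the inverse is 0 by convention, so the bound is trivial there. *)
  move=> Dz; have [y0|y0] := eqVneq (enorm (c z)) 0.
    rewrite y0 invr0 expr0n/= adde_ge0// nneseries_ge0// => n _ _.
  have {}y0 : 0 < enorm (c z) by rewrite lt0r y0 sqrtr_ge0.
  have [N yN] : exists N, 2 ^- N < enorm (c z).
    (* With y the Euclidean norm and N the integer part of 1/y, one has 1/y < N + 1 <= 2^N. *)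
    exists (Num.truncn (enorm (c z))^-1).
    rewrite -[ltRHS]invrK ltf_pV2 ?posrE ?invr_gt0//.
    rewrite (lt_le_trans (truncnS_gt _))// -natrX ler_nat.
    by rewrite ltn_expl.
  apply: le_trans (leeD2l _ (nneseries_lim_ge N (fun n _ _ => a0 n z))).
  rewrite sumEFin -EFinD lee_fin (le_trans (exprVn_le_dyadic yN))// lerD2l.
  apply: ler_sum => n _; rewrite ler_wpM2l ?exprn_ge0//.
  case: (leP _ (2 ^- n)) => // yn; rewrite indicE mem_set//.
  by split => //=; exact: le_trans (norm_le_enorm _) yn.
have mD := measurable_box M.
apply: (@le_lt_trans _ _ (\int[leb6]_(z in box M)
    (1 + \sum_(0 <= n <oo) a n z))%E).
  apply: ge0_le_integral => //.
  - by move=> z _; rewrite lee_fin exprn_ge0// invr_ge0 sqrtr_ge0.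
  - apply/measurable_EFinP/measurable_funX/measurable_funTS.
    exact: measurable_inv_enorm.
  - exact: emeasurable_funD.
rewrite ge0_integralD//; last first.
  by move=> z _; rewrite nneseries_ge0.
have -> : (\int[leb6]_(z in box M) 1 = 1 * leb6 (box M))%E.
  exact: integral_cst.
rewrite mul1e; apply: lte_add_pinfty; first exact: leb6_box.
rewrite integral_nneseries//; last by move=> n; exact: ma.
(* The bound 4 K 2^-n is written with denominator 2^(n+1), hence the extra factor 2, to match the
   geometric series summed at the end. *)
apply: (@le_lt_trans _ _
  (\sum_(0 <= n <oo) (4 * K * 2 / (2 ^ (n + 1))%:R)%:E)%E).
  apply: lee_nneseries => [n _ _|n _]; first exact: integral_ge0.
  rewrite /a; under eq_integral do rewrite EFinM.
  rewrite ge0_integralZl//; last first.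
    by apply/measurable_EFinP; apply: measurable_indic; exact: mA.
  rewrite integral_indic//; last exact: mA.
  have -> : A n `&` box M = A n by apply/setIidPl; apply: subIsetl.
  have r0 : 0 <= 2 ^- n :> R by rewrite invr_ge0 exprn_ge0.
  apply: (@le_trans _ _ ((4 ^+ n.+1)%:E * (K * (2 ^- n) ^+ 3)%:E)%E).
    by rewrite lee_wpmul2l ?lee_fin ?exprn_ge0//; exact: leK.
  rewrite -EFinM lee_fin le_eqVlt; apply/orP; left; apply/eqP.
  have n0 : 2 ^+ n != 0 :> R by rewrite expf_neq0.
  have -> : 4 ^+ n.+1 = 4 * 2 ^+ n * 2 ^+ n :> R.
    by rewrite exprS -mulrA -exprMn; congr (_ * _ ^+ _); ring.
  have -> : (2 ^ (n + 1))%:R = 2 * 2 ^+ n :> R by rewrite addn1 natrX exprS.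
  by field.
have /cvg_lim lim_ser := @cvg_geometric_eseries_half R (4 * K * 2) 0.
by rewrite [X in (X < _)%E]lim_ser ?ltry.
Qed.

End CoulombL2.

(** * Integrability of a potential times an L^2 function times a test function *)

Section Pairing.
Variable R : realType.
Local Open Scope classical_set_scope.

(** This class of multipliers contains the constants, which account for the mass terms, and the
    Coulomb potentials, and it is closed under linear combinations. *)
Definition locL2 (U : R6 R -> R) : Prop :=
  measurable_fun setT U /\
  forall M, 0 <= M -> (\int[leb6]_(z in box M) (U z ^+ 2)%:E < +oo)%E.

Lemma locL2_cst (c : R) : locL2 (cst c).
Proof.
split=> // M M0.
have -> : (\int[leb6]_(z in box M) (cst c z ^+ 2)%:E
    = (c ^+ 2)%:E * leb6 (box M))%E.
  by rewrite (integral_cst leb6 (measurable_box M) (c ^+ 2)%:E).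
by rewrite lte_mul_pinfty ?lee_fin ?sqr_ge0 ?leb6_box.
Qed.

Lemma locL2Z (c : R) (U : R6 R -> R) : locL2 U -> locL2 (fun z => c * U z).
Proof.
move=> [mU iU]; split; first exact: measurable_funM.
move=> M M0; under eq_integral do rewrite exprMn EFinM.
rewrite ge0_integralZl//; first by rewrite lte_mul_pinfty ?lee_fin ?sqr_ge0 ?iU.
- exact: measurable_box.
- by apply/measurable_EFinP/measurable_funX/measurable_funTS.
- by move=> z _; rewrite lee_fin sqr_ge0.
- by rewrite lee_fin sqr_ge0.
Qed.

(** Follows from (U + W)^2 <= 2 (U^2 + W^2). *)
Lemma locL2D (U W : R6 R -> R) : locL2 U -> locL2 W ->
  locL2 (fun z => U z + W z).
Proof.
move=> [mU iU] [mW iW]; split; first exact: measurable_funD.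
move=> M M0; have mD := @measurable_box R M.
apply: (@le_lt_trans _ _ (\int[leb6]_(z in box M)
  (2%:E * ((U z ^+ 2)%:E + (W z ^+ 2)%:E)))%E).
  apply: ge0_le_integral => //.
  - by move=> z _; rewrite lee_fin sqr_ge0.
  - by apply/measurable_EFinP/measurable_funX/measurable_funTS/measurable_funD.
  - apply: measurable_funeM; apply: emeasurable_funD;
      by apply/measurable_EFinP/measurable_funX/measurable_funTS.
  - move=> z _; rewrite -EFinD -EFinM lee_fin.
    by have := sqr_ge0 (U z - W z); nra.
have s0 (X : R6 R -> R) z : (0 <= (X z ^+ 2)%:E)%E by rewrite lee_fin sqr_ge0.
have mX (X : R6 R -> R) : measurable_fun setT X ->
    measurable_fun (box M) (fun z => (X z ^+ 2)%:E).
  by move=> mX; apply/measurable_EFinP/measurable_funX/measurable_funTS.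
rewrite ge0_integralZl//; last 2 first.
- by apply: emeasurable_funD; apply: mX.
- by move=> z _; rewrite adde_ge0.
rewrite ge0_integralD//; [|exact: mX|exact: mX].
by rewrite lte_mul_pinfty// lte_add_pinfty ?iU ?iW.
Qed.

(** If [|b| <= C] and [b] vanishes off a box, then |U a b| is dominated by C (U^2 1_box + a^2),
    because |U| |a| <= U^2 + a^2. *)
Lemma integrable_pairing (U a b : R6 R -> R) (K : set (R6 R)) :
  locL2 U -> a \in @Lfun _ _ R leb6 2%:E -> continuous b -> compact K ->
  (forall z, b z != 0 -> K z) ->
  leb6.-integrable setT (fun z => (U z * a z * b z)%:E).
Proof.
move=> [mU iU] La cb cK bK.
have mb := continuous_measurable_R6 cb.
have ma : measurable_fun setT a by have /sub_Lfun_mfun := La; rewrite inE.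
have [C C0 bC] : exists2 C, 0 <= C & forall z, `|b z| <= C.
  have := compact_bounded (continuous_compact (continuous_subspaceT cb) cK).
  (* Boundedness provides a bound by every number above [C0]; this one is moreover nonnegative. *)
  case=> C0 [_ /(_ (`|C0| + 1))]; rewrite (le_lt_trans (ler_norm _)) ?ltrDl//.
  move=> /(_ isT) h; exists (`|C0| + 1); first by rewrite addr_ge0.
  move=> z; have [->|bz] := eqVneq (b z) 0; first by rewrite normr0 addr_ge0.
  by apply: h; exists z => //; exact: bK.
have [M M0 KM] : exists2 M, 0 <= M & K `<=` box M.
  case: (compact_bounded cK) => C0' [_ /(_ (`|C0'| + 1))].
  rewrite (le_lt_trans (ler_norm _)) ?ltrDl// => /(_ isT) h.
  by exists (`|C0'| + 1) => //; rewrite addr_ge0.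
have mD := @measurable_box R M.
have i1 : leb6.-integrable setT ((fun z => (U z ^+ 2)%:E) \_ (box M)).
  rewrite -integrable_mkcond//; apply/integrableP; split.
    by apply/measurable_EFinP/measurable_funX/measurable_funTS.
  rewrite (le_lt_trans _ (iU M M0))// le_eqVlt; apply/orP; left; apply/eqP.
  by apply: eq_integral => z _; rewrite gee0_abs// lee_fin sqr_ge0.
have i2 := Lfun2_integrable_sqr La.
apply: (le_integrable measurableT _ _
  (integrableZl measurableT C (integrableD measurableT i1 i2))).
  by apply/measurable_EFinP; do 2?apply: measurable_funM.
move=> z _ /=; rewrite patchE; case: ifPn => [zM|zM].
  rewrite -EFinD -EFinM lee_fin [leRHS]ger0_norm; last first.
    by rewrite mulr_ge0// addr_ge0// sqr_ge0.
  rewrite normrM mulrC ler_pM// normrM.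
  have := sqr_ge0 (`|U z| - `|a z|); rewrite -(real_normK (num_real (U z))).
  rewrite -(real_normK (num_real (a z))).
  by have := normr_ge0 (U z); have := normr_ge0 (a z); nra.
have -> : b z = 0.
  apply/eqP; apply: contraNT zM => /bK /KM; exact: mem_set.
by rewrite mulr0 normr0 abse_ge0.
Qed.

Lemma locL2_inv_enorm1 : locL2 (fun z => (enorm z.1)^-1).
Proof.
have cc : continuous (fst : R6 R -> R3 R) by move=> z; exact: cvg_fst.
split; first exact: measurable_inv_enorm.
move=> M M0.
(* The set lies in a cube of half-side [r] times one of half-side [M], and (2r)^3 (2M)^3 = 8 (2M)^3
   r^3. *)
apply: (@integral_sqr_inv_enorm _ _ _ (8 * (2 * M) ^+ 3)) => // r r0.
apply: le_trans (leb6_slab (g := cst 0) r0 M0 _ _) _.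
- by apply: measurableI; [exact: measurable_box|exact: measurable_norm_le].
- by move=> z [+ /= ->]; rewrite /box /= prod_normE ge_max subr0 => /andP[].
by rewrite lee_fin le_eqVlt; apply/orP; left; apply/eqP; ring.
Qed.

Lemma locL2_inv_enorm2 : locL2 (fun z => (enorm z.2)^-1).
Proof.
have cc : continuous (snd : R6 R -> R3 R) by move=> z; exact: cvg_snd.
split; first exact: measurable_inv_enorm.
move=> M M0.
apply: (@integral_sqr_inv_enorm _ _ _ (8 * (2 * M) ^+ 3)) => // r r0.
apply: le_trans (leb6_slab (g := cst 0) M0 r0 _ _) _.
- by apply: measurableI; [exact: measurable_box|exact: measurable_norm_le].
- by move=> z [+ /=]; rewrite /box /= prod_normE ge_max subr0 => /andP[].
by rewrite lee_fin le_eqVlt; apply/orP; left; apply/eqP; ring.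
Qed.

(** Here the slab bound is used with [g = id]: for fixed x_1, the variable x_2 ranges over a cube
    centred at x_1. *)
Lemma locL2_inv_enormB : locL2 (fun z => (enorm (z.1 - z.2))^-1).
Proof.
have cc : continuous (fun z : R6 R => z.1 - z.2).
  by move=> z; apply: cvgB; [exact: cvg_fst|exact: cvg_snd].
split; first exact: measurable_inv_enorm.
move=> M M0.
apply: (@integral_sqr_inv_enorm _ _ _ (8 * (2 * M) ^+ 3)) => // r r0.
apply: le_trans (leb6_slab (g := id) M0 r0 _ _) _.
- by apply: measurableI; [exact: measurable_box|exact: measurable_norm_le].
- move=> z [+ /= zr]; rewrite /box /= prod_normE ge_max distrC zr.
  by case/andP.
by rewrite lee_fin le_eqVlt; apply/orP; left; apply/eqP; ring.
Qed.

End Pairing.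

(** * Additivity of multiplication operators *)

Section MulpotLinear.
Variable R : realType.
Local Open Scope complex_scope.
Implicit Types (f : R6 R -> R[i]) (U W : R6 R -> R).

Lemma integrable_mulpot_Re U f (phi : testfun (R6 R)) : locL2 U -> L2 f ->
  leb6.-integrable setT
    (EFin \o (fun z => complex.Re ((U z)%:C * f z * phi z))).
Proof.
move=> lU [Lr Li].
have cr : continuous (fun z => complex.Re (phi z)).
  by move=> z; exact: differentiable_continuous (tf_Re phi [::] z).
have ci : continuous (fun z => complex.Im (phi z)).
  by move=> z; exact: differentiable_continuous (tf_Im phi [::] z).
have supp z : phi z != 0 -> closure [set x | phi x != 0]%classic z.
  by move=> pz; exact: subset_closure.
have ir := integrable_pairing lU Lr cr (@tf_supp _ _ phi).
have ii := integrable_pairing lU Li ci (@tf_supp _ _ phi).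
apply: eq_integrable (integrableB measurableT (ir _) (ii _)) => //.
- move=> z _ /=; rewrite -EFinB; congr EFin.
  by case: (f z) (phi z) => [a b] [c d] /=; ring.
- by move=> z pz; apply: supp; apply: contraNneq pz => ->.
- by move=> z pz; apply: supp; apply: contraNneq pz => ->.
Qed.

(** Since Im w = Re (-i w), this is the real case for the function -i f. *)
Lemma integrable_mulpot_Im U f (phi : testfun (R6 R)) : locL2 U -> L2 f ->
  leb6.-integrable setT
    (EFin \o (fun z => complex.Im ((U z)%:C * f z * phi z))).
Proof.
move=> lU [Lr Li].
have L2i : L2 (fun z => - 'i * f z).
  split.
    rewrite (_ : (fun x => _) = fun x => complex.Im (f x))//.
    by apply/funext => z; case: (f z) => a b /=; ring.
  have -> : (fun x => complex.Im (- 'i * f x)) =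
      -1 \o* (fun x => complex.Re (f x)).
    by apply: funext => z /=; case: (f z) => a b /=; ring.
  by apply: Lfun_scale => //; rewrite ler1n.
apply: eq_integrable (integrable_mulpot_Re phi lU L2i) => // z _ /=.
by case: (f z) (phi z) => [a b] [c d] /=; congr EFin; ring.
Qed.

Lemma mulpotD U W f : locL2 U -> locL2 W -> L2 f ->
  mulpot (@int6 R) (fun z => U z + W z) f =
  mulpot (@int6 R) U f + mulpot (@int6 R) W f.
Proof.
move=> lU lW Lf; apply: (@funext (testfun (R6 R)) R[i]) => phi.
rewrite [RHS]/GRing.add/=.
rewrite /mulpot /reg /int6 [RHS]/GRing.add/=; congr (_ +i* _).
  rewrite -RintegralD//; last 2 first.
  - exact: integrable_mulpot_Re.
  - exact: integrable_mulpot_Re.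
  by apply: eq_Rintegral => z _; case: (f z) (phi z) => [a b] [c d] /=; ring.
rewrite -RintegralD//; last 2 first.
- exact: integrable_mulpot_Im.
- exact: integrable_mulpot_Im.
by apply: eq_Rintegral => z _; case: (f z) (phi z) => [a b] [c d] /=; ring.
Qed.

(** Turns a mass term, which is a scalar multiple of [reg], into a multiplication operator, so that
    it can be merged with the potentials. *)
Lemma mulpot_cst (c : R) f : L2 f ->
  mulpot (@int6 R) (fun=> c) f = c%:C *: reg (@int6 R) f.
Proof.
move=> Lf; apply: (@funext (testfun (R6 R)) R[i]) => phi.
rewrite [RHS]/GRing.scale/=.
(* The factor 1 exhibits the integrand as a pairing with the constant multiplier 1, whose
   integrability is known. *)
have Re1 z : complex.Re (f z * phi z) = complex.Re (1%:C * f z * phi z).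
  by rewrite mul1r.
have Im1 z : complex.Im (f z * phi z) = complex.Im (1%:C * f z * phi z).
  by rewrite mul1r.
have l1 := @locL2_cst R 1.
have ir := integrable_mulpot_Re phi l1 Lf.
have ii := integrable_mulpot_Im phi l1 Lf.
rewrite /mulpot /reg /int6 [RHS]/GRing.scale/= /GRing.mul/= !mul0r subr0 addr0.
congr (_ +i* _).
  under [X in _ = _ * X]eq_Rintegral do rewrite Re1.
  rewrite -RintegralZl//.
  by apply: eq_Rintegral => z _; case: (f z) (phi z) => [a b] [d e] /=; ring.
under [X in _ = _ * X]eq_Rintegral do rewrite Im1.
rewrite -RintegralZl//.
by apply: eq_Rintegral => z _; case: (f z) (phi z) => [a b] [d e] /=; ring.
Qed.

End MulpotLinear.

(** * Kronecker products and block structure *)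

Section OperatorSums.
Variables (R : realType) (E : Type) (D : lmodType R[i]).

Lemma sum_mxtens (V : nmodType) m n (F : 'I_(m * n) -> V) :
  \sum_r F r = \sum_(s < m) \sum_(t < n) F (mxtens_index (s, t)).
Proof.
rewrite pair_big /= (reindex (@mxtens_index m n)) /=.
  by apply: eq_bigr => -[].
exists (@mxtens_unindex m n) => r _.
  exact: mxtens_indexK.
exact: mxtens_unindexK.
Qed.

Lemma opmul_kronl1 m n (A : 'M[E -> D]_m) (x : 'cV[E]_(m * n)) s t :
  opmul (kronl A (1%:M : 'M[R[i]]_n)) x (mxtens_index (s, t)) 0 =
  \sum_s' A s s' (x (mxtens_index (s', t)) 0).
Proof.
rewrite mxE sum_mxtens; apply: eq_bigr => s' _.
rewrite (bigD1 t)//= big1 ?addr0 => [|t' /negPf t't].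
  by rewrite mxE !mxtens_indexK/= mxE eqxx scale1r.
by rewrite mxE !mxtens_indexK/= mxE eq_sym t't scale0r.
Qed.

Lemma opmul_kronr1 m n (B : 'M[E -> D]_n) (x : 'cV[E]_(m * n)) s t :
  opmul (kronr (1%:M : 'M[R[i]]_m) B) x (mxtens_index (s, t)) 0 =
  \sum_t' B t t' (x (mxtens_index (s, t')) 0).
Proof.
rewrite mxE sum_mxtens (bigD1 s)//= [X in _ + X]big1 ?addr0 => [|s' /negPf s's].
  by apply: eq_bigr => t' _; rewrite mxE !mxtens_indexK/= mxE eqxx scale1r.
apply: big1 => t' _.
by rewrite mxE !mxtens_indexK/= mxE eq_sym s's scale0r.
Qed.

Lemma opmulD m n (A B : 'M[E -> D]_(m, n)) (x : 'cV[E]_n) :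
  opmul (A + B) x = opmul A x + opmul B x.
Proof.
by apply/colP => i; rewrite !mxE -big_split; apply: eq_bigr => j _; rewrite mxE.
Qed.

Lemma opmulDE m n (A B : 'M[E -> D]_(m, n)) (x : 'cV[E]_n) i :
  opmul (A + B) x i 0 = opmul A x i 0 + opmul B x i 0.
Proof. by rewrite opmulD mxE. Qed.

End OperatorSums.

Lemma opmul_diagop (R : realType) (V : normedModType R) n
    (T : (V -> R[i]) -> dist V) (x : 'cV[V -> R[i]]_n) r :
  opmul (diagop n T) x r 0 = T (x r 0).
Proof.
rewrite mxE (bigD1 r)//= big1 ?addr0 => [|j /negPf jr].
  by rewrite mxE eqxx.
by rewrite mxE eq_sym jr.
Qed.

Lemma opmul_seqmx4 (E D : nmodType) (rows : seq (seq (E -> D)))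
    (cols : seq (seq E)) (r : 'I_4) :
  let t (c : nat) : D :=
    nth 0 (nth [::] rows r) c (nth 0 (nth [::] cols c) 0%N) in
  opmul (seqmx rows : 'M[E -> D]_4) (seqmx cols) r 0 =
     t 0%N + t 1%N + t 2%N + t 3%N.
Proof.
by rewrite /= mxE !big_ord_recr big_ord0 /= add0r !mxE /=.
Qed.

Lemma stackE (E : nmodType) (X : 'M['cV[E]_4]_2) (a b : 'I_2) :
  stack X (spin a b) 0 = Mat (X a b).
Proof. by rewrite mxE; move: a b; do 2! apply: ord2P. Qed.

(** [Mat] fills columns first: the column index belongs to the first particle and the row index to
    the second. Hence matrices acting on particle 1 multiply transposed from the right, and those
    acting on particle 2 from the left. *)
Lemma MatE (E : nmodType) (a : 'cV[E]_4) (i j : 'I_2) :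
  Mat a i j = a (spin j i) 0.
Proof.
rewrite mxE; move: i j; do 2! (apply: ord2P);
  by rewrite /=; congr (a _ _); apply: val_inj.
Qed.

Lemma MatK (E : nmodType) (a : 'cV[E]_4) : vec (Mat a) = a.
Proof.
apply/colP => r; case: (@mxtens_indexP 2 2 r) => i j.
by rewrite mxE; move: i j; do 2! (apply: ord2P); rewrite /= MatE.
Qed.

(** Allows the 2 + 2 block matrices [alpha] and [beta] to be read off at pairs (block, position). *)
Lemma spinE (a i : 'I_2) :
  spin a i = if a == 0 then lshift 2 i else rshift 2 i.
Proof. by apply: val_inj; move: a i; do 2! (apply: ord2P). Qed.

(** * Entries of the one-particle Dirac operator *)

Section DiracEntries.
Variables (R : realType) (V : normedModType R) (I : (V -> R) -> R).
Variables (e : 'I_3 -> V) (x : V -> R3 R) (m k : R).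

Lemma alpha_spin (l : 'I_3) (a c i j : 'I_2) :
  alpha l (spin a i) (spin c j) = (a != c)%:R * sigma l i j :> R[i].
Proof.
rewrite /alpha !spinE; move: a c; do 2! (apply: ord2P);
  (* The index types ['I_4] and ['I_(2 + 2)] agree by conversion, which [etrans] accepts. *)
  [apply: etrans (block_mxEul _ _ _ _ _ _) _
  |apply: etrans (block_mxEur _ _ _ _ _ _) _
  |apply: etrans (block_mxEdl _ _ _ _ _ _) _
  |apply: etrans (block_mxEdr _ _ _ _ _ _) _];
  by rewrite ?mxE ?mul0r ?mul1r.
Qed.

Lemma beta_spin (a c i j : 'I_2) :
  beta (spin a i) (spin c j) = (-1) ^+ a * ((a, i) == (c, j))%:R :> R[i].
Proof.
rewrite /beta !spinE xpair_eqE; move: a c; do 2! (apply: ord2P);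
  [apply: etrans (block_mxEul _ _ _ _ _ _) _
  |apply: etrans (block_mxEur _ _ _ _ _ _) _
  |apply: etrans (block_mxEdl _ _ _ _ _ _) _
  |apply: etrans (block_mxEdr _ _ _ _ _ _) _];
  by rewrite ?mxE ?expr0 ?expr1 ?mulr0 ?mul1r ?mulN1r.
Qed.

(** [rev_ord] exchanges the upper and lower parts, the only coupling made by [alpha]. Directions [e]
    and position [x] are kept general so that the lemma serves both particles. *)
Lemma dirac_op_spin (X : 'cV[V -> R[i]]_4) (a i : 'I_2) :
  opmul (dirac_op I e x m k) X (spin a i) 0 =
  \sum_(j < 2) \sum_l
    sigma l i j *: mom (e l) (reg I (X (spin (rev_ord a) j) 0))
  + ((-1) ^+ a * m%:C)%C *: reg I (X (spin a i) 0)
  + mulpot I (fun z => k / enorm (x z)) (X (spin a i) 0).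
Proof.
rewrite !opmulD 2!mxE opmul_diagop; congr (_ + _ + _).
  rewrite mxE (@sum_mxtens _ 2 2) (bigD1 (rev_ord a))//=.
  rewrite [X in _ + X]big1 ?addr0.
    apply: eq_bigr => j _; rewrite mxE fct_sumE; apply: eq_bigr => l _.
    by rewrite alpha_spin; move: a; apply: ord2P; rewrite mul1r.
  move=> c ca; apply: big1 => j _; rewrite mxE fct_sumE; apply: big1 => l _.
  (* There are only two blocks, so one that differs from [rev_ord a] is [a]. *)
  have -> : a = c by apply/val_inj; move: a c ca; do 2! apply: ord2P.
  by rewrite alpha_spin eqxx mul0r scale0r.
rewrite mxE (@sum_mxtens _ 2 2) (bigD1 a)//= (bigD1 i)//= !big1 ?addr0.
- by rewrite 2!mxE beta_spin eqxx mulr1 mulrC.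
- move=> c ca; apply: big1 => j _.
  by rewrite 2!mxE beta_spin xpair_eqE eq_sym (negPf ca) !mulr0 scale0r.
- move=> j ji.
  by rewrite 2!mxE beta_spin xpair_eqE (eq_sym i) (negPf ji) andbF !mulr0
    scale0r.
Qed.

End DiracEntries.

(** * Blocks of the two-particle operator *)

Section TwoBodyEntries.
Variable R : realType.
Local Open Scope complex_scope.
Implicit Type Psi : 'M['cV[R6 R -> R[i]]_4]_2.

Lemma flat_spin (E : Type) (X : 'M['cV[E]_4]_2) (a b i j : 'I_2) :
  flat X (mxtens_index (spin a i, spin b j)) 0 = X a b (spin i j) 0.
Proof. by rewrite mxE mxtens_indexK /spin !mxtens_indexK. Qed.

Lemma unflat_spin (E : Type) (v : 'cV[E]_(4 * 4)) (a b i j : 'I_2) :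
  unflat v a b (spin i j) 0 = v (mxtens_index (spin a i, spin b j)) 0.
Proof. by rewrite !mxE mxtens_indexK. Qed.

Lemma h1E (x : 'cV[R6 R -> R[i]]_4) (i j : 'I_2) :
  h1 (Mat x) i j =
  \sum_(j' < 2) \sum_l sigma l j j' *: p1 l (x (spin j' i) 0).
Proof.
rewrite /h1 MatK MatE.
apply: etrans (@opmul_kronl1 _ _ _ 2 2 _ x j i) _; apply: eq_bigr => j' _.
by rewrite mxE fct_sumE.
Qed.

Lemma h2E (x : 'cV[R6 R -> R[i]]_4) (i j : 'I_2) :
  h2 (Mat x) i j =
  \sum_(i' < 2) \sum_l sigma l i i' *: p2 l (x (spin j i') 0).
Proof.
rewrite /h2 MatK MatE.
apply: etrans (@opmul_kronr1 _ _ _ 2 2 _ x j i) _; apply: eq_bigr => i' _.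
by rewrite mxE fct_sumE.
Qed.

(** The terms are merged one at a time from the left, each partial sum being again locally square
    integrable. *)
Lemma mulpot_total (c k k0 : R) (f : R6 R -> R[i]) : L2 f ->
  mulpot (@int6 R) (fun z => c + Vpot k k0 z) f =
  c%:C *: reg (@int6 R) f
  + mulpot (@int6 R) (fun z => k / enorm z.1) f
  + mulpot (@int6 R) (fun z => k / enorm z.2) f
  + mulpot (@int6 R) (fun z => k0 / enorm (z.1 - z.2)) f.
Proof.
move=> Lf.
have l1 := locL2Z k (locL2_inv_enorm1 R).
have l2 := locL2Z k (locL2_inv_enorm2 R).
have l0 := locL2Z k0 (locL2_inv_enormB R).
have lc1 := locL2D (locL2_cst c) l1.
rewrite -mulpot_cst// -(mulpotD (locL2_cst c) l1 Lf) -(mulpotD lc1 l2 Lf).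
rewrite -(mulpotD (locL2D lc1 l2) l0 Lf).
by congr mulpot; apply/funext => z; rewrite /Vpot !addrA.
Qed.

Lemma applyHDC_spin (m k k0 : R) Psi (a b i j : 'I_2) :
  L2 (Psi a b (spin i j) 0) ->
  applyHDC m k k0 Psi a b (spin i j) 0 =
  \sum_(i' < 2) \sum_l sigma l i i' *: p1 l (Psi (rev_ord a) b (spin i' j) 0)
  + \sum_(j' < 2) \sum_l sigma l j j' *: p2 l (Psi a (rev_ord b) (spin i j') 0)
  + mulpot (@int6 R)
      (fun z => ((-1) ^+ a + (-1) ^+ b) * m + Vpot k k0 z)
      (Psi a b (spin i j) 0).
Proof.
move=> Lf; rewrite /p1 /p2 /applyHDC /HDC unflat_spin 2!opmulDE.
(* [X] and [Y] are the one-particle spinors obtained by freezing the index of the other particle. *)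
pose X := \col_s flat Psi (mxtens_index (s, spin b j)) 0.
pose Y := \col_t flat Psi (mxtens_index (spin a i, t)) 0.
transitivity (opmul (H_1 m k) X (spin a i) 0 + opmul (H_2 m k) Y (spin b j) 0 +
    mulpot (@int6 R) (fun z => k0 / enorm (z.1 - z.2)) (Psi a b (spin i j) 0)).
  congr (_ + _ + _).
  - apply: etrans (@opmul_kronl1 _ _ _ 4 4 _ _ _ _) _.
    by rewrite [RHS]mxE; apply: eq_bigr => s _; rewrite [X in _ = _ X]mxE.
  - apply: etrans (@opmul_kronr1 _ _ _ 4 4 _ _ _ _) _.
    by rewrite [RHS]mxE; apply: eq_bigr => s _; rewrite [X in _ = _ X]mxE.
  - by apply: etrans (@opmul_diagop _ _ (4 * 4) _ _ _) _; rewrite flat_spin.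
rewrite mulpot_total//.
have XE c h : X (spin c h) 0 = Psi c b (spin h j) 0 by rewrite mxE flat_spin.
have YE c h : Y (spin c h) 0 = Psi a c (spin i h) 0 by rewrite mxE flat_spin.
rewrite !dirac_op_spin !XE !YE.
have sum_sign : (((-1) ^+ a + (-1) ^+ b) * m)%:C =
    (-1) ^+ a * m%:C + (-1) ^+ b * m%:C :> R[i].
  by rewrite mulrDl rmorphD !rmorphM !rmorphXn !rmorphN1.
(* Summands 1 to 3 are kinetic, mass and Coulomb terms of particle 1, 4 to 6 those of particle 2,
   and 7 is the interaction. The kinetic terms go first; the rest follow the order of
   [mulpot_total]. *)
rewrite sum_sign scalerDl [LHS](AC (3*3*1) ((1*4)*((((2*5)*3)*6)*7))).
by apply: (f_equal2 +%R (f_equal2 +%R _ _) erefl);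
  apply: eq_bigr => c _; rewrite ?XE ?YE.
Qed.

Lemma Mat_applyHDC (m k k0 : R) Psi (a b : 'I_2) :
  (forall r, L2 (Psi a b r 0)) ->
  Mat (applyHDC m k k0 Psi a b) =
  h1 (Mat (Psi (rev_ord a) b)) + h2 (Mat (Psi a (rev_ord b)))
  + scal (fun z => ((-1) ^+ a + (-1) ^+ b) * m + Vpot k k0 z) (Mat (Psi a b)).
Proof.
move=> Lf; apply/matrixP => i j.
rewrite [LHS]MatE [LHS]applyHDC_spin// [RHS]mxE [X in _ = X + _]mxE.
apply: (f_equal2 +%R (f_equal2 +%R _ _) _).
- by rewrite h1E.
- by rewrite h2E.
- by rewrite [RHS]mxE MatE.
Qed.

End TwoBodyEntries.

Theorem proposition5p1 (R : realType) (m k k0 : R) (hm : 0 <= m)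
    (Psi : 'M['cV[R6 R -> R[i]]_4]_2)
    (hPsi : forall (a b : 'I_2) (r : 'I_4), L2 (Psi a b r 0)) :
  let V : R6 R -> R := Vpot k k0 in
  let psi (i j : 'I_2) : 'M[R6 R -> R[i]]_2 := Mat (Psi i j) in
  [/\ stack (applyHDC m k k0 Psi) =
      opmul
        (seqmx
           [:: [:: scal (fun z => 2 * m + V z); h2; h1; 0];
               [:: h2; scal V; 0; h1];
               [:: h1; 0; scal V; h2];
               [:: 0; h1; h2; scal (fun z => - (2 * m - V z))]]
         : 'M[_]_4)
        (seqmx [:: [:: psi 0 0]; [:: psi 0 1]; [:: psi 1 0]; [:: psi 1 1]]),
      forall i j : 'I_2,
        h1 (psi i j) = Mat (opmul sigp1_I (Psi i j)) /\
        h1 (psi i j) =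
          \sum_(l < 3) rmx (map_mx (p1 l) (psi i j)) (sigma l)^T
    & forall i j : 'I_2,
        h2 (psi i j) = Mat (opmul I_sigp2 (Psi i j)) /\
        h2 (psi i j) =
          \sum_(l < 3) lmx (sigma l) (map_mx (p2 l) (psi i j))].
Proof.
move=> V psi; split=> [|i j|i j].
- apply/colP => r; case: (@mxtens_indexP 2 2 r) => a b.
  rewrite [LHS]stackE [RHS]opmul_seqmx4.
  have rev0 : rev_ord 0 = 1 :> 'I_2 by exact: val_inj.
  have rev1 : rev_ord 1 = 0 :> 'I_2 by exact: val_inj.
  rewrite Mat_applyHDC//; move: a b; do 2! (apply: ord2P);
    rewrite /= ?rev0 ?rev1 /psi.
  + have -> : (fun z => ((-1) ^+ 0 + (-1) ^+ 0) * m + Vpot k k0 z) =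
        (fun z => 2 * m + V z) by apply/funext => z; rewrite expr0.
    (* The zero entry, in the column of the block with both indices flipped, is the zero operator
       and vanishes by computation. *)
    rewrite [X in _ = _ + X](_ : _ = 0)// addr0.
    by rewrite [RHS](ACl (3*2*1)).
  (* [1 %% 2] is the value of the index 1 in ['I_2]. In the mixed blocks the two signs are opposite
     and the masses cancel. *)
  + have -> : (fun z => ((-1) ^+ 0 + (-1) ^+ (1 %% 2)) * m + Vpot k k0 z) = V.
      by apply/funext => z; rewrite expr0 expr1 addrN mul0r add0r.
    rewrite [X in _ = _ + X + _](_ : _ = 0)// addr0.
    by rewrite [RHS](ACl (3*1*2)).
  + have -> : (fun z => ((-1) ^+ (1 %% 2) + (-1) ^+ 0) * m + Vpot k k0 z) = V.
      by apply/funext => z; rewrite expr0 expr1 addNr mul0r add0r.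
    rewrite [X in _ = _ + X + _ + _](_ : _ = 0)// addr0.
    by rewrite [RHS](ACl (1*3*2)).
  + have -> : (fun z => ((-1) ^+ (1 %% 2) + (-1) ^+ (1 %% 2)) * m
        + Vpot k k0 z) = (fun z => - (2 * m - V z)).
      by apply/funext => z; rewrite expr1 /V; ring.
    by rewrite [X in _ = X + _ + _ + _](_ : _ = 0)// add0r.
- split; first by rewrite /h1 MatK.
  apply/matrixP => r c; rewrite h1E summxE exchange_big; apply: eq_bigr => l _.
  rewrite [RHS]mxE; apply: eq_bigr => c' _.
  by rewrite [(sigma l)^T _ _]mxE [map_mx _ _ _ _]mxE MatE.
- split; first by rewrite /h2 MatK.
  apply/matrixP => r c; rewrite h2E summxE exchange_big; apply: eq_bigr => l _.
  rewrite [RHS]mxE; apply: eq_bigr => c' _.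
  by rewrite [map_mx _ _ _ _]mxE MatE.
Qed.
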